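(* For a partition $\lambda$ let $L(\lambda)$ be its largest part (with $L(\emptyset)=0$), and for $r\ge1$ let $$P_{L,r}(q)=\sum_{n\ge0}\sum_{\lambda\vdash n}L(\lambda)^rq^n,\qquad \mathcal{P}_{L,r}(q)=(q)_\infty P_{L,r}(q),\qquad D_r(q)=\sum_{m\ge1}\sigma_{r-1}(m)q^m.$$ Then for every $r\ge1$, $$\mathcal{P}_{L,r}(q)=\sum_{\lambda\vdash r}\phi_B(\lambda)\,D_\lambda,$$ and conversely, for every $k\ge1$, $$D_k(q)=\sum_{\lambda\vdash k}\mu(\lambda)\,\phi_B(\lambda)\,\mathcal{P}_{L,\lambda}(q).$$
   Context: $(q)_\infty=\prod_{j\ge1}(1-q^j)$ and $\sigma_j(n)=\sum_{d\mid n}d^j$ for $j\ge0$. A partition $\lambda\vdash n$ is written $\lambda=(1^{m_1},\ldots,n^{m_n})$, with $m_j\ge0$ the multiplicity of the part $j$ and $\sum_jjm_j=n$; $\ell(\lambda)=m_1+\cdots+m_n$. Define $D_\lambda=\prod_jD_j(q)^{m_j}$ and $\mathcal{P}_{L,\lambda}(q)=\prod_j\mathcal{P}_{L,j}(q)^{m_j}$. For $\lambda\vdash n$, $$\phi_B(\lambda)=n!\prod_{j=1}^n\frac{1}{m_j!\,(j!)^{m_j}},\qquad \mu(\lambda)=(-1)^{\ell(\lambda)-1}(\ell(\lambda)-1)!.$$ *)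

(* Defs.v *)
From HB Require Import structures.
From mathcomp Require Import all_boot all_order all_algebra.
From mathcomp Require Import boolp classical_sets.

Set Implicit Arguments.
Unset Strict Implicit.
Unset Printing Implicit Defensive.

Import GRing.Theory.
Local Open Scope ring_scope.

(* ------------------------------------------------------------------------ *)
(* Formal power series: Fps a stands for the sum over n >= 0 of a n * q^n;  *)
(* they form a commutative algebra under the Cauchy product.                *)
(* ------------------------------------------------------------------------ *)

Record fps (R : comNzRingType) := Fps { fcoef : nat -> R }.

Lemma fpsP (R : comNzRingType) (f g : fps R) :
  (forall n, fcoef f n = fcoef g n) <-> f = g.
Proof.
split=> [|-> //]; case: f g => [a] [b] /= eq_ab.
by congr Fps; apply/funext.
Qed.

HB.instance Definition _ (R : comNzRingType) := gen_eqMixin (fps R).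
HB.instance Definition _ (R : comNzRingType) := gen_choiceMixin (fps R).

Definition fps_zero (R : comNzRingType) : fps R := Fps (fun=> 0).
Definition fps_add (R : comNzRingType) (f g : fps R) : fps R :=
  Fps (fun n => fcoef f n + fcoef g n).
Definition fps_opp (R : comNzRingType) (f : fps R) : fps R :=
  Fps (fun n => - fcoef f n).
Definition fps_one (R : comNzRingType) : fps R :=
  Fps (fun n => (n == 0%N)%:R).
Definition fps_mul (R : comNzRingType) (f g : fps R) : fps R :=
  Fps (fun n => \sum_(i < n.+1) fcoef f i * fcoef g (n - i)).
Definition fps_scale (R : comNzRingType) (c : R) (f : fps R) : fps R :=
  Fps (fun n => c * fcoef f n).

Definition fps_trunc (R : comNzRingType) (N : nat) (f : fps R) : {poly R} :=
  \poly_(i < N) fcoef f i.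

Lemma fcoef_mul_trunc (R : comNzRingType) (f g : fps R) n N M :
  (n < N)%N -> (n < M)%N ->
  fcoef (fps_mul f g) n = (fps_trunc N f * fps_trunc M g)`_n.
Proof.
move=> nN nM; rewrite coefM; apply: eq_bigr => i _; rewrite !coef_poly.
have in_ : (i <= n)%N by rewrite -ltnS.
by rewrite (leq_ltn_trans in_ nN) (leq_ltn_trans (leq_subr _ _) nM).
Qed.

Fact fps_addA (R : comNzRingType) : associative (@fps_add R).
Proof. by move=> f g h; apply/fpsP => n /=; rewrite addrA. Qed.

Fact fps_addC (R : comNzRingType) : commutative (@fps_add R).
Proof. by move=> f g; apply/fpsP => n /=; rewrite addrC. Qed.

Fact fps_add0 (R : comNzRingType) : left_id (fps_zero R) (@fps_add R).
Proof. by move=> f; apply/fpsP => n /=; rewrite add0r. Qed.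

Fact fps_addN (R : comNzRingType) :
  left_inverse (fps_zero R) (@fps_opp R) (@fps_add R).
Proof. by move=> f; apply/fpsP => n /=; rewrite addNr. Qed.

HB.instance Definition _ (R : comNzRingType) :=
  GRing.isZmodule.Build (fps R)
    (@fps_addA R) (@fps_addC R) (@fps_add0 R) (@fps_addN R).

Fact fps_mulA (R : comNzRingType) : associative (@fps_mul R).
Proof.
have trE (f g : fps R) n i : (i <= n)%N ->
    (fps_trunc n.+1 (fps_mul f g))`_i
      = (fps_trunc n.+1 f * fps_trunc n.+1 g)`_i.
  by move=> i_n; rewrite coef_poly ltnS i_n; apply: fcoef_mul_trunc.
move=> f g h; apply/fpsP => n.
rewrite !(@fcoef_mul_trunc _ _ _ n n.+1 n.+1) //.
transitivity ((fps_trunc n.+1 f * (fps_trunc n.+1 g * fps_trunc n.+1 h))`_n).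
  by rewrite !coefM; apply: eq_bigr => i _; rewrite trE ?leq_subr.
rewrite mulrA !coefM; apply: eq_bigr => i _.
by rewrite trE // -ltnS.
Qed.

Fact fps_mulC (R : comNzRingType) : commutative (@fps_mul R).
Proof.
move=> f g; apply/fpsP => n.
by rewrite !(@fcoef_mul_trunc _ _ _ n n.+1 n.+1) // mulrC.
Qed.

Fact fps_mul1 (R : comNzRingType) : left_id (fps_one R) (@fps_mul R).
Proof.
move=> f; apply/fpsP => n /=; rewrite big_ord_recl /= mul1r subn0.
by rewrite big1 ?addr0 // => i _; rewrite mul0r.
Qed.

Fact fps_mulD (R : comNzRingType) :
  left_distributive (@fps_mul R) (@fps_add R).
Proof.
move=> f g h; apply/fpsP => n /=; rewrite -big_split.
by apply: eq_bigr => i _; rewrite mulrDl.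
Qed.

Fact fps_one_neq0 (R : comNzRingType) : fps_one R != fps_zero R.
Proof. by apply/eqP => /fpsP /(_ 0%N) /= /eqP; rewrite oner_eq0. Qed.

HB.instance Definition _ (R : comNzRingType) :=
  GRing.Zmodule_isComNzRing.Build (fps R)
    (@fps_mulA R) (@fps_mulC R) (@fps_mul1 R) (@fps_mulD R) (@fps_one_neq0 R).

Fact fps_scaleA (R : comNzRingType) (a b : R) (f : fps R) :
  fps_scale a (fps_scale b f) = fps_scale (a * b) f.
Proof. by apply/fpsP => n /=; rewrite mulrA. Qed.

Fact fps_scale1 (R : comNzRingType) : left_id 1 (@fps_scale R).
Proof. by move=> f; apply/fpsP => n /=; rewrite mul1r. Qed.

Fact fps_scaleDr (R : comNzRingType) : right_distributive (@fps_scale R) +%R.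
Proof. by move=> a f g; apply/fpsP => n /=; rewrite mulrDr. Qed.

Fact fps_scaleDl (R : comNzRingType) (f : fps R) :
  {morph (@fps_scale R)^~ f : a b / a + b}.
Proof. by move=> a b; apply/fpsP => n /=; rewrite mulrDl. Qed.

HB.instance Definition _ (R : comNzRingType) :=
  GRing.Zmodule_isLmodule.Build R (fps R)
    (@fps_scaleA R) (@fps_scale1 R) (@fps_scaleDr R) (@fps_scaleDl R).

Fact fps_scaleAl (R : comNzRingType) (a : R) (f g : fps R) :
  a *: (f * g) = (a *: f) * g.
Proof.
apply/fpsP => n /=; rewrite mulr_sumr.
by apply: eq_bigr => i _; rewrite mulrA.
Qed.

HB.instance Definition _ (R : comNzRingType) :=
  GRing.Lmodule_isLalgebra.Build R (fps R) (@fps_scaleAl R).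

Fact fps_scaleAr (R : comNzRingType) (a : R) (f g : fps R) :
  a *: (f * g) = f * (a *: g).
Proof. by rewrite mulrC fps_scaleAl mulrC. Qed.

HB.instance Definition _ (R : comNzRingType) :=
  GRing.Lalgebra_isAlgebra.Build R (fps R) (@fps_scaleAr R).

Definition fps_q (R : comNzRingType) : fps R := Fps (fun n => (n == 1%N)%:R).

(* Convergence in the q-adic topology: each coefficient is eventually       *)
(* constant.  fps_lim u is the limit of u if it exists, and 0 otherwise.    *)
Definition fps_cvg (R : comNzRingType) (u : nat -> fps R) (f : fps R) : Prop :=
  forall n, exists N, forall m, (N <= m)%N -> fcoef (u m) n = fcoef f n.

Definition fps_lim (R : comNzRingType) (u : nat -> fps R) : fps R :=
  xget 0 (fun f => fps_cvg u f).

Lemma fps_cvg_unique (R : comNzRingType) (u : nat -> fps R) (f g : fps R) :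
  fps_cvg u f -> fps_cvg u g -> f = g.
Proof.
move=> uf ug; apply/fpsP => n.
have [N Nf] := uf n; have [M Mg] := ug n.
by rewrite -(Nf _ (leq_maxl N M)) -(Mg _ (leq_maxr N M)).
Qed.

Lemma fps_limE (R : comNzRingType) (u : nat -> fps R) (f : fps R) :
  fps_cvg u f -> fps_lim u = f.
Proof.
move=> uf; apply: xget_unique => // g ug.
exact: fps_cvg_unique ug uf.
Qed.

(* (q)_oo, with the convergence of its partial products. *)
Definition qinf_partial (R : comNzRingType) (N : nat) : fps R :=
  \prod_(1 <= j < N.+1) (1 - fps_q R ^+ j).

Definition qinf (R : comNzRingType) : fps R := fps_lim (qinf_partial R).

Lemma fcoef_q_exp (R : comNzRingType) j n :
  fcoef (fps_q R ^+ j) n = (n == j)%:R.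
Proof.
elim: j n => [//|j IHj] n; rewrite exprS /=; case: n => [|n].
  by rewrite big_ord_recl big_ord0 /= mul0r addr0.
rewrite 2!big_ord_recl /= mul0r add0r mul1r subn1 /= IHj.
by rewrite big1 ?addr0 // => i _; rewrite mul0r.
Qed.

Lemma qinf_partial_stable (R : comNzRingType) n m :
  (n <= m)%N -> fcoef (qinf_partial R m) n = fcoef (qinf_partial R n) n.
Proof.
move=> /subnK <-; elim: (m - n)%N => [//|k IHk]; rewrite addSn -IHk.
rewrite {1}/qinf_partial big_nat_recr //= -/(qinf_partial R _).
rewrite big_ord_recr /= subnn fcoef_q_exp /= oppr0 addr0 mulr1.
rewrite big1 ?add0r // => i _; rewrite fcoef_q_exp.
have ni : (n - i != 0)%N by rewrite subn_eq0 -ltnNge.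
have nk : (n - i == (k + n).+1)%N = false.
  by apply/negbTE; rewrite ltn_eqF // ltnS (leq_trans (leq_subr _ _)) ?leq_addl.
by rewrite nk (negbTE ni) subr0 mulr0.
Qed.

Lemma qinf_cvg (R : comNzRingType) : fps_cvg (qinf_partial R) (qinf R).
Proof.
have cv : fps_cvg (qinf_partial R)
            (Fps (fun n => fcoef (qinf_partial R n) n)).
  by move=> n; exists n => m; exact: qinf_partial_stable.
by rewrite /qinf (fps_limE cv).
Qed.

(* ------------------------------------------------------------------------ *)
(* Partitions of n as multiplicity vectors: for j : 'I_n, la j is the       *)
(* multiplicity of the part j.+1.  The bound la j <= n built into the type  *)
(* follows from the sum condition; it only serves to make the type finite.  *)
(* ------------------------------------------------------------------------ *)

Record intpart (n : nat) := IntPart {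
  multiplicity :> {ffun 'I_n -> 'I_n.+1};
  _ : (\sum_(j < n) j.+1 * multiplicity j == n)%N
}.

HB.instance Definition _ (n : nat) := [isSub of intpart n for @multiplicity n].
HB.instance Definition _ (n : nat) := [Finite of intpart n by <:].

Definition largest_part (n : nat) (la : intpart n) : nat :=
  (\max_(j < n | 0 < la j) j.+1)%N.

Definition plength (n : nat) (la : intpart n) : nat := (\sum_(j < n) la j)%N.

Definition phiB (n : nat) (la : intpart n) : rat :=
  n`!%:R * \prod_(j < n) (1 / ((la j)`!%:R * j.+1`!%:R ^+ la j)).

(* Used for n >= 1 only, where plength la >= 1. *)
Definition mu (n : nat) (la : intpart n) : rat :=
  (-1) ^+ (plength la - 1)%N * (plength la - 1)%N`!%:R.

Definition sigma (k n : nat) : nat := (\sum_(d <- divisors n) d ^ k)%N.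

Definition P_L (r : nat) : fps rat :=
  Fps (fun n => \sum_(la : intpart n) (largest_part la)%:R ^+ r).

Definition calP_L (r : nat) : fps rat := qinf rat * P_L r.

(* Used for r >= 1 only. *)
Definition D (r : nat) : fps rat :=
  Fps (fun m => if (0 < m)%N then (sigma (r - 1)%N m)%:R else 0).

Definition D_part (n : nat) (la : intpart n) : fps rat :=
  \prod_(j < n) D j.+1 ^+ la j.

Definition calP_L_part (n : nat) (la : intpart n) : fps rat :=
  \prod_(j < n) calP_L j.+1 ^+ la j.

(* Main.v *)
(** Write [l] for the number of parts and [n] for the size of a partition.
    Conjugation turns the largest part into [l], so [P_L r] is the [r]-th
    moment series of [l].  Removing [d] copies of a part of size [m], for all
    [d, m >= 1], gives
      [sum l * l^r q^n = sum_(d, m) q^(d m) sum (l + d)^r q^n],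
    which after expansion and multiplication by [(q)_oo] reads
      [calP (r+1) = sum_k 'C(r, k) D (k+1) calP (r-k)],  with [calP 0 = 1].
    Hence the exponential generating functions satisfy
      [sum calP_r x^r / r! = exp (sum D_r x^r / r!)],
    and the two formulas are the expansions of [exp] and [log] over
    partitions.  Both expansions are again computed by removing a part. *)

Require Import Defs.
From mathcomp Require Import all_boot all_order all_algebra.
From mathcomp Require Import boolp.
From mathcomp Require Import zify.
Local Open Scope ring_scope.

Set Implicit Arguments.
Unset Strict Implicit.
Unset Printing Implicit Defensive.
Import GRing.Theory Num.Theory.

(** * Partitions as finitely supported functions on the naturals *)

Definition mult_fun n (la : intpart n) (i : nat) : nat :=
  oapp (fun j : 'I_n => la j : nat) 0%N (insub i).

Definition weight N (f : nat -> nat) : nat := (\sum_(i < N) i.+1 * f i)%N.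

(** With plain functions, partitions of all sizes share one type, so a part can be removed without
    changing the bounds in a dependent type. Index [i] stands for the part [i.+1]. *)
Definition is_part n (f : nat -> nat) :=
  (forall i, (n <= i)%N -> f i = 0%N) /\ weight n f = n.

Lemma mult_funE n (la : intpart n) (j : 'I_n) : mult_fun la j = la j.
Proof. by rewrite /mult_fun valK. Qed.

Lemma mult_fun_inj n : injective (@mult_fun n).
Proof.
move=> la mu eq_f; apply/val_inj/ffunP => j; apply/val_inj.
by rewrite /= -!mult_funE eq_f.
Qed.

Lemma is_part_mult n (la : intpart n) : is_part n (mult_fun la).
Proof.
split=> [i ni|]; first by rewrite /mult_fun insubF // ltnNge ni.
rewrite -[RHS](eqP (valP la)); apply: eq_bigr => j _; by rewrite mult_funE.
Qed.

Lemma weight_ge f N i : (i < N)%N -> (i.+1 * f i <= weight N f)%N.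
Proof. by move=> iN; rewrite /weight (bigD1 (Ordinal iN)) //= leq_addr. Qed.

Lemma weight_widen f n N : (n <= N)%N -> (forall i, (n <= i)%N -> f i = 0%N) ->
  weight N f = weight n f.
Proof.
move=> nN f0; rewrite /weight (big_ord_widen _ (fun i => i.+1 * f i)%N nN).
rewrite [RHS]big_mkcond /=; apply: eq_bigr => i _.
by case: ltnP => // /f0 ->; rewrite muln0.
Qed.

(** Any bound [N] on the support may replace [n]: a part larger than [n] that occurred would alone
    exceed the total weight. *)
Lemma is_partP f N n : (forall i, (N <= i)%N -> f i = 0%N) -> weight N f = n ->
  is_part n f.
Proof.
move=> f0 wf.
have fz i : (n <= i)%N -> f i = 0%N.
  move=> ni; case: (ltnP i N) => [iN|/f0 //]; have := weight_ge f iN.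
  by rewrite wf; case: (f i) => // k; nia.
split=> //; have [nN|/ltnW Nn] := leqP n N;
  first by rewrite -{2}wf -(weight_widen nN fz).
by rewrite (weight_widen Nn f0).
Qed.

Lemma is_part_weight f n N : is_part n f -> (n <= N)%N -> weight N f = n.
Proof. by move=> [f0 wf] nN; rewrite (weight_widen nN). Qed.

Lemma is_part_le f n i : is_part n f -> (i.+1 * f i <= n)%N.
Proof.
move=> pf; have [ni|ni] := leqP n i; first by rewrite pf.1 ?muln0.
by rewrite -[X in (_ <= X)%N]pf.2 weight_ge.
Qed.

Definition parts n : seq (nat -> nat) := [seq mult_fun la | la : intpart n].

Lemma parts_uniq n : uniq (parts n).
Proof. by rewrite map_inj_uniq ?enum_uniq //; apply: mult_fun_inj. Qed.

Lemma mem_parts n f : (f \in parts n) <-> is_part n f.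
Proof.
split=> [/mapP[la _ ->]|pf]; first exact: is_part_mult.
have fn i : (f i < n.+1)%N by rewrite ltnS; have := is_part_le i pf; nia.
have /eqP sf : (\sum_(j < n) j.+1 * [ffun j : 'I_n => inord (f j) : 'I_n.+1] j)%N = n.
  by rewrite -[RHS]pf.2; apply: eq_bigr => j _; rewrite ffunE inordK.
apply/mapP; exists (IntPart sf); rewrite ?mem_enum //.
apply/funext => i; have [ni|ni] := leqP n i.
  by rewrite pf.1 // (is_part_mult _).1.
by have := mult_funE (IntPart sf) (Ordinal ni) => /= ->; rewrite ffunE inordK.
Qed.

Lemma sum_parts (V : nmodType) n (F : (nat -> nat) -> V) :
  \sum_(la : intpart n) F (mult_fun la) = \sum_(f <- parts n) F f.
Proof. by rewrite big_image. Qed.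

(** * Adding and removing copies of a part *)

Definition num_parts n (f : nat -> nat) : nat := (\sum_(i < n) f i)%N.

Lemma plengthE n (la : intpart n) : plength la = num_parts n (mult_fun la).
Proof. by apply: eq_bigr => j _; rewrite mult_funE. Qed.

Lemma num_parts_widen f n N : is_part n f -> (n <= N)%N ->
  num_parts N f = num_parts n f.
Proof.
move=> pf nN; rewrite /num_parts (big_ord_widen _ f nN) [RHS]big_mkcond /=.
by apply: eq_bigr => i _; case: ltnP => // /(pf.1).
Qed.

Definition add_part (j d : nat) (f : nat -> nat) : nat -> nat :=
  fun i => (f i + (i == j) * d)%N.

Lemma weight_add_part j d f N : (j < N)%N ->
  weight N (add_part j d f) = (weight N f + j.+1 * d)%N.
Proof.
move=> jN; rewrite /weight /add_part (eq_bigr _ (fun i _ => mulnDr _ _ _)).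
rewrite big_split /=; congr (_ + _)%N.
rewrite (bigD1 (Ordinal jN)) //= eqxx mul1n big1 ?addn0 // => i.
by rewrite -val_eqE /= => /negbTE ->; rewrite mul0n muln0.
Qed.

Lemma num_parts_add_part j d f N : (j < N)%N ->
  num_parts N (add_part j d f) = (num_parts N f + d)%N.
Proof.
move=> jN; rewrite /num_parts /add_part big_split /=; congr (_ + _)%N.
rewrite (bigD1 (Ordinal jN)) //= eqxx mul1n big1 ?addn0 // => i.
by rewrite -val_eqE /= => /negbTE ->.
Qed.

Lemma is_part_add n j d f : is_part n f ->
  is_part (n + j.+1 * d) (add_part j d f).
Proof.
move=> pf; apply: (@is_partP _ (n + j.+1)); last first.
  by rewrite weight_add_part ?(is_part_weight pf) //; lia.
move=> i ni; have ij : (i == j) = false by apply/negbTE; lia.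
by rewrite /add_part ij addn0 (pf.1 _ (leq_trans (leq_addr _ _) ni)).
Qed.

Lemma is_part_sub n j d f : is_part n f -> (d <= f j)%N ->
  exists2 g, f = add_part j d g & is_part (n - j.+1 * d) g.
Proof.
move=> pf df; pose g i := (f i - (i == j) * d)%N.
have fg : f = add_part j d g.
  by apply/funext => i; rewrite /add_part /g; case: eqP => [->|_]; lia.
exists g => //; apply: (@is_partP _ (n + j.+1)).
  by move=> i ni; rewrite /g (pf.1 _ (leq_trans (leq_addr _ _) ni)).
have := is_part_weight pf (leq_addr j.+1 n).
by rewrite {1}fg weight_add_part; lia.
Qed.

Lemma perm_remove_part n j d : (j.+1 * d <= n)%N ->
  perm_eq [seq f <- parts n | (d <= f j)%N]
          [seq add_part j d g | g <- parts (n - j.+1 * d)].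
Proof.
move=> jd; apply: uniq_perm.
- exact: filter_uniq (parts_uniq n).
- rewrite map_inj_uniq ?parts_uniq // => f g fg; apply/funext => i.
  by have /(congr1 (fun h => h i)) := fg; rewrite /add_part => /addIn.
move=> f; rewrite mem_filter; apply/andP/mapP => [[df /mem_parts pf]|[g gp ->]].
  by have [g fg pg] := is_part_sub pf df; exists g => //; apply/mem_parts.
split; first by rewrite /add_part eqxx mul1n leq_addl.
apply/mem_parts; rewrite -[n in is_part n _](subnK jd).
by apply: is_part_add; apply/mem_parts.
Qed.

Lemma sum_remove_part (V : nmodType) n j d (F : (nat -> nat) -> V) :
  \sum_(f <- parts n | (d <= f j)%N) F f =
  if (j.+1 * d <= n)%N then
    \sum_(g <- parts (n - j.+1 * d)) F (add_part j d g) else 0.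
Proof.
case: ifPn => [jd|].
  by rewrite -big_filter (perm_big _ (perm_remove_part jd)) big_map.
rewrite -ltnNge => jd; rewrite big_seq_cond big1 // => f /andP[/mem_parts pf df].
by have := is_part_le j pf; nia.
Qed.

(** * Conjugation, exchanging largest part and number of parts *)

(* With [f i] the multiplicity of the part [i.+1], as for [intpart], this is *)
(* row [i] of the conjugate partition. *)
Definition tail n (f : nat -> nat) i : nat := (\sum_(k < n | (i <= k)%N) f k)%N.

Lemma tailS n f i : (i < n)%N -> tail n f i = (f i + tail n f i.+1)%N.
Proof.
move=> ni; rewrite /tail (bigD1 (Ordinal ni)) //=; congr (_ + _)%N.
by apply: eq_bigl => k; rewrite -val_eqE /=; lia.
Qed.

Lemma tail_homo n f i j : (i <= j)%N -> (tail n f j <= tail n f i)%N.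
Proof.
move=> ij; rewrite /tail [X in (X <= _)%N]big_mkcond [X in (_ <= X)%N]big_mkcond /=.
apply: leq_sum => k _; case: (leqP j k) => // jk.
by rewrite (leq_trans ij jk).
Qed.

Lemma tail_at0 n f : tail n f 0 = num_parts n f.
Proof. by apply: eq_bigl. Qed.

Lemma sum_tail n f : (\sum_(i < n) tail n f i)%N = weight n f.
Proof.
rewrite /tail /weight; under eq_bigr do rewrite big_mkcond.
rewrite exchange_big /=; apply: eq_bigr => k _.
rewrite -big_mkcond sum_nat_const /=; congr (_ * _)%N.
rewrite -sum1_card (eq_bigl (fun i : 'I_n => (i < k.+1)%N)) //.
by rewrite -(big_ord_widen _ (fun=> 1%N)) ?ltn_ord // sum1_card card_ord.
Qed.

Lemma tail_le n f i : is_part n f -> (tail n f i <= n)%N.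
Proof.
move=> pf; rewrite -[X in (_ <= X)%N]pf.2 /tail big_mkcond; apply: leq_sum => k _.
by case: ifP => // _; nia.
Qed.

Definition conj_part n (f : nat -> nat) (j : nat) : nat :=
  (\sum_(i < n) (tail n f i == j.+1))%N.

(** Both sides count the conjugate rows longer than [j]; by [tail_le] each such row has its length
    counted exactly once among the indices below [n]. *)
Lemma tail_conj n f j : is_part n f ->
  tail n (conj_part n f) j = (\sum_(i < n) (j < tail n f i))%N.
Proof.
move=> pf; rewrite /tail /conj_part exchange_big /=; apply: eq_bigr => i _.
rewrite -/(tail n f i); have := tail_le i pf.
case: (tail n f i) => [|t] tn.
  by rewrite big1.
rewrite big_mkcond (bigD1 (Ordinal tn)) //= eqxx big1 ?addn0.
  by rewrite ltnS; case: leqP.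
by move=> k; rewrite -val_eqE /= eqSS eq_sym => /negbTE ->; case: ifP.
Qed.

Lemma is_part_conj_part n f : is_part n f -> is_part n (conj_part n f).
Proof.
move=> pf; split=> [j nj|].
  rewrite /conj_part big1 // => i _; apply/eqP; rewrite eqb0.
  by rewrite ltn_eqF // ltnS (leq_trans (tail_le i pf)).
rewrite -sum_tail; under eq_bigr do rewrite tail_conj //.
rewrite exchange_big /= -[RHS]pf.2 -sum_tail; apply: eq_bigr => i _.
rewrite -[LHS]/(\sum_(j < n) (if (j < tail n f i) then 1 else 0))%N.
rewrite -big_mkcond /= -(big_ord_widen _ (fun=> 1%N)) ?tail_le //.
by rewrite sum1_card card_ord.
Qed.

Lemma sum_ltn n m : (\sum_(j < n) (j < m))%N = minn m n.
Proof.
elim: n => [|n IHn]; first by rewrite big_ord0 minn0.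
by rewrite big_ord_recr /= IHn; case: ltnP; lia.
Qed.

(* Since tail is decreasing, #{k | j < tail k} is the first k with tail k <= j. *)
Lemma count_tail n f i j : (i < n)%N ->
  (i < \sum_(k < n) (j < tail n f k))%N = (j < tail n f i)%N.
Proof.
move=> ni; have [jt|tj] := ltnP j (tail n f i).
  apply: (@leq_trans (\sum_(k < n) (k < i.+1))); first by rewrite sum_ltn; lia.
  apply: leq_sum => k _; case: (ltnP k i.+1) => // ki.
  by rewrite (leq_trans jt) // tail_homo.
apply/negbTE; rewrite -leqNgt.
apply: (@leq_trans (\sum_(k < n) (k < i))); last by rewrite sum_ltn; lia.
apply: leq_sum => k _; case: (ltnP k i) => // ki; first exact: leq_b1.
by rewrite ltnNge (leq_trans (tail_homo _ _ ki)).
Qed.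

Lemma tail_conjK n f i : is_part n f -> (i < n)%N ->
  tail n (conj_part n (conj_part n f)) i = tail n f i.
Proof.
move=> pf ni; rewrite tail_conj; last exact: is_part_conj_part.
under eq_bigr do rewrite tail_conj // count_tail //.
by rewrite sum_ltn; have := tail_le i pf; lia.
Qed.

(** A multiplicity is the difference of two consecutive tails, so it suffices that double
    conjugation preserves tails. At the last index the second tail is an empty sum. *)
Lemma conj_partK n f : is_part n f -> conj_part n (conj_part n f) = f.
Proof.
move=> pf; have pc := is_part_conj_part (is_part_conj_part pf).
apply/funext => i; have [ni|ni] := leqP n i; first by rewrite pf.1 ?pc.1.
have := tail_conjK pf ni; rewrite (tailS _ ni) (tailS f ni).
have [ni'|ni'] := ltnP i.+1 n; first by rewrite tail_conjK // => /addIn.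
have t0 g : tail n g i.+1 = 0%N.
  by rewrite /tail big1 // => k ik; have := ltn_ord k; lia.
by rewrite !t0 !addn0.
Qed.

Lemma perm_conj n : perm_eq (map (conj_part n) (parts n)) (parts n).
Proof.
have uc : uniq (map (conj_part n) (parts n)).
  rewrite map_inj_in_uniq ?parts_uniq // => f g /mem_parts pf /mem_parts pg fg.
  by rewrite -(conj_partK pf) fg conj_partK.
apply: uniq_perm; rewrite ?parts_uniq // => f; apply/mapP/idP.
  by move=> [g /mem_parts pg ->]; apply/mem_parts/is_part_conj_part.
move=> /mem_parts pf; exists (conj_part n f); rewrite ?conj_partK //.
exact/mem_parts/is_part_conj_part.
Qed.

(** The parts of the conjugate are its nonempty rows, and row [i] is nonempty exactly when some part
    exceeds [i], that is, when [i] is below the largest part. *)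
Lemma num_parts_conj_part n (la : intpart n) :
  num_parts n (conj_part n (mult_fun la)) = largest_part la.
Proof.
have pf := is_part_mult la; rewrite -tail_at0 tail_conj //.
set f := mult_fun la in pf *; rewrite /largest_part.
apply/eqP; rewrite eqn_leq; apply/andP; split.
  case: (boolP [exists i : 'I_n, (0 < tail n f i)%N]) => [/existsP[i0 _]|]; last first.
    rewrite negb_exists => /forallP t0; rewrite big1 // => i _.
    by rewrite (negbTE (t0 i)).
  set M := (\max_(_ < _ | _) _)%N; apply: (@leq_trans (\sum_(i < n) (i < M))).
    apply: leq_sum => i _; case: (ltnP 0 (tail n f i)) => // ti.
    have : [exists k : 'I_n, (i <= k)%N && (0 < la k)%N].
      apply: contraLR ti; rewrite negb_exists => /forallP H.
      rewrite -leqNgt leqn0 /tail big1 // => k ik; rewrite /f mult_funE.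
      by have := H k; rewrite ik /= -leqNgt leqn0 => /eqP.
    move=> /existsP[k /andP[ik lk]].
    suff: (k.+1 <= M)%N by move=> kM; rewrite (leq_ltn_trans ik kM).
    exact: (@leq_bigmax_cond _ _ (fun j : 'I_n => j.+1)).
  by rewrite sum_ltn; lia.
apply/bigmax_leqP => k lk.
apply: (@leq_trans (\sum_(i < n) (i < k.+1))).
  by rewrite sum_ltn; have := ltn_ord k; lia.
apply: leq_sum => i _; case: (ltnP i k.+1) => // ik.
by rewrite lt0b /tail (bigD1 k) //= /f mult_funE; lia.
Qed.

Lemma coef_P_L r n :
  fcoef (P_L r) n = \sum_(f <- parts n) (num_parts n f)%:R ^+ r.
Proof.
rewrite -(perm_big _ (perm_conj n)) big_map -sum_parts /=.
by apply: eq_bigr => la _; rewrite num_parts_conj_part.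
Qed.

(** * Exponential and logarithm as sums over partitions *)

Section WeightedPartitionSums.

Variable A : comAlgType rat.
Implicit Types (y p : nat -> A) (h : nat -> rat).

Definition part_weight N y (f : nat -> nat) : A :=
  \prod_(i < N) ((f i)`!%:R^-1 *: y i.+1 ^+ f i).

(** With Y = sum over i >= 1 of y_i x^i and H(t) = sum of h(l) t^l / l!, this is the coefficient of
    x^n in H(Y). Replacing [h] by [h \o succn] replaces H by H'. *)
Definition part_sum y h n : A :=
  \sum_(f <- parts n) h (num_parts n f) *: part_weight n y f.

Lemma part_weight_widen y f n N : is_part n f -> (n <= N)%N ->
  part_weight N y f = part_weight n y f.
Proof.
move=> pf nN; rewrite /part_weight.
rewrite (big_ord_widen _ (fun i => (f i)`!%:R^-1 *: y i.+1 ^+ f i) nN).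
rewrite [RHS]big_mkcond /=; apply: eq_bigr => i _.
by case: ltnP => // /(pf.1) ->; rewrite expr0 fact0 invr1 scale1r.
Qed.

Lemma part_weight_add N y j g : (j < N)%N ->
  (g j).+1%:R *: part_weight N y (add_part j 1 g) = y j.+1 * part_weight N y g.
Proof.
move=> jN; rewrite /part_weight.
rewrite (bigD1 (Ordinal jN)) //= [in RHS](bigD1 (Ordinal jN)) //= -!scalerAl.
rewrite {1 2}/add_part eqxx mul1n addn1 scalerA factS natrM.
rewrite invfM mulVKf ?pnatr_eq0 // exprS -mulrA -scalerAr.
congr (_ *: (_ * (_ * _))); apply: eq_bigr => i; rewrite -val_eqE /= => /negbTE ij.
by rewrite /add_part ij mul0n addn0.
Qed.

(** The factor [f j] marks one copy of the part [j.+1]. Removing that copy cancels [f j] against the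
    factorial in the weight and releases one factor [y j.+1]. *)
Lemma sum_mult_part_weight y h (c : nat -> rat) n :
  \sum_(f <- parts n)
     (h (num_parts n f) * \sum_(j < n) c j * (f j)%:R) *: part_weight n y f =
  \sum_(j < n) (c j *: y j.+1) * part_sum y (h \o succn) (n - j.+1).
Proof.
under eq_bigr do rewrite mulr_sumr scaler_suml.
rewrite exchange_big /=; apply: eq_bigr => j _.
have jn : (j.+1 * 1 <= n)%N by rewrite muln1.
transitivity (\sum_(f <- parts n | (1 <= f j)%N)
   (h (num_parts n f) * (c j * (f j)%:R)) *: part_weight n y f).
  rewrite [RHS]big_mkcond /=; apply: eq_bigr => f _.
  by case: (f j) => //=; rewrite !mulr0 scale0r.
rewrite sum_remove_part jn muln1 mulr_sumr.
rewrite !big_seq; apply: eq_bigr => g /mem_parts pg.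
rewrite num_parts_add_part // addn1 (num_parts_widen pg) ?leq_subr //.
rewrite {1}/add_part eqxx mul1n addn1 mulrA -scalerA part_weight_add //.
rewrite (part_weight_widen _ pg) ?leq_subr //.
by rewrite mulrC -!scalerA /= -scalerAl -scalerAr [RHS]scalerA mulrC -scalerA.
Qed.

(** The chain rule x d/dx H(Y) = (x Y') H'(Y), obtained by writing [n] as the sum of all parts. *)
Lemma part_sum_theta y h n :
  n%:R *: part_sum y h n =
  \sum_(j < n) (j.+1%:R *: y j.+1) * part_sum y (h \o succn) (n - j.+1).
Proof.
rewrite -(sum_mult_part_weight y h (fun j => j.+1%:R)) /part_sum scaler_sumr.
rewrite !big_seq; apply: eq_bigr => f /mem_parts pf.
rewrite scalerA mulrC; congr ((_ * _) *: _).
by rewrite -[in LHS]pf.2 natr_sum; apply: eq_bigr => j _; rewrite natrM.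
Qed.

(** The coefficient form of t H'(t) at t = Y: here every part is marked with coefficient 1. *)
Lemma sum_len_part_weight y h n :
  \sum_(f <- parts n) (h (num_parts n f) * (num_parts n f)%:R) *: part_weight n y f =
  \sum_(j < n) y j.+1 * part_sum y (h \o succn) (n - j.+1).
Proof.
under [RHS]eq_bigr do rewrite -[y _]scale1r.
rewrite -(sum_mult_part_weight y h (fun=> 1)); apply: eq_bigr => f _.
congr ((_ * _) *: _); rewrite /num_parts natr_sum.
by apply: eq_bigr => j _; rewrite mul1r.
Qed.

Lemma part_sum0 y h : part_sum y h 0 = (h 0%N)%:A.
Proof.
have p0 : perm_eq (parts 0) [:: fun=> 0%N].
  apply: uniq_perm; rewrite ?parts_uniq // => f; rewrite inE.
  apply/idP/eqP => [/mem_parts[f0 _]|->]; first by apply/funext => i; exact: f0.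
  by apply/mem_parts; split => //; rewrite /weight big_ord0.
by rewrite /part_sum (perm_big _ p0) big_seq1 /num_parts /part_weight !big_ord0.
Qed.

Lemma natr_scaleI n (a b : A) : n.+1%:R *: a = n.+1%:R *: b :> A -> a = b.
Proof.
move=> /(congr1 ( *:%R n.+1%:R^-1)).
by rewrite !scalerA mulVf ?pnatr_eq0 // !scale1r.
Qed.

(* Coefficient form of [p' = y' p], that is, [p = exp y]. *)
Definition exp_rec y p := forall n,
  n.+1%:R *: p n.+1 = \sum_(j < n.+1) (j.+1%:R *: y j.+1) * p (n - j)%N.

(** A constant [h] is fixed by the shift, so [part_sum_theta] is the same recursion as [exp_rec];
    over the rationals it determines the sequence from its initial value. *)
Lemma exp_partsE y p : p 0%N = 1 -> exp_rec y p ->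
  forall n, p n = part_sum y (fun=> 1) n.
Proof.
move=> p0 py n; elim/ltn_ind: n => -[_|n IHn]; first by rewrite part_sum0 scale1r.
apply: (@natr_scaleI n); rewrite py part_sum_theta; apply: eq_bigr => j _.
by rewrite subSS IHn // ltnS leq_subr.
Qed.

(** These are the coefficients h of H(t) = 1 + log(1 + t): truncated subtraction gives
    [log_coef 0 = 1], a constant that [theta] later removes. *)
Definition log_coef (l : nat) : rat := (-1) ^+ (l - 1) * (l - 1)`!%:R.

Lemma log_coefS l : (0 < l)%N -> log_coef l.+1 = - (log_coef l * l%:R).
Proof.
case: l => // l _; rewrite /log_coef !subn1 /= exprS mulN1r factS natrM.
by rewrite mulNr -mulrA [_`!%:R * _]mulrC.
Qed.

Definition theta (F : fps A) : fps A := Fps (fun n => n%:R *: fcoef F n).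

Lemma fcoef_mulS (F G : fps A) n : fcoef F 0%N = 0 ->
  fcoef (F * G) n = \sum_(j < n) fcoef F j.+1 * fcoef G (n - j.+1).
Proof. by move=> F0 /=; rewrite big_ord_recl /= F0 mul0r add0r. Qed.

(* With [1/p] the series with coefficients [part_sum p (log_coef \o succn)], *)
(* both [log p] and [y] have derivative [p'/p]. *)
Lemma log_partsE y p : p 0%N = 1 -> exp_rec y p ->
  forall n, y n.+1 = part_sum p log_coef n.+1.
Proof.
move=> p0 py.
pose P := Fps p; pose Y := Fps y; pose C := Fps (part_sum p log_coef).
pose E := Fps (part_sum p (log_coef \o succn)).
have PE : P * E = 1.
  apply/fpsP => -[|n].
    by rewrite /= big_ord_recl big_ord0 addr0 /= p0 mul1r part_sum0 /= scale1r.
  (* In positive degree a partition with [l] parts contributes [log_coef l.+1 + log_coef l * l],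
     which vanishes since l > 0. This is (1 + t) H'(t) = 1. *)
  rewrite /= big_ord_recl /= p0 mul1r subn0 -[X in _ + X]sum_len_part_weight.
  rewrite /part_sum -big_split big_seq big1 //= => f /mem_parts pf.
  rewrite -scalerDl log_coefS ?addNr ?scale0r //.
  rewrite lt0n; apply/negP; rewrite sum_nat_eq0 => /forallP f0.
  by have := pf.2; rewrite /weight big1 // => i _; rewrite (eqP (f0 i)) muln0.
have thP : theta P = theta Y * P.
  apply/fpsP => -[|n]; rewrite fcoef_mulS /= ?scale0r ?big_ord0 //.
have thC : theta C = theta P * E.
  by apply/fpsP => n; rewrite fcoef_mulS /= ?scale0r // part_sum_theta.
have thY : theta C = theta Y by rewrite thC thP -mulrA PE mulr1.
by move=> n; apply: (@natr_scaleI n); have /fpsP/(_ n.+1) := thY.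
Qed.

End WeightedPartitionSums.

(** * The recurrence for the moment series *)

Lemma fcoef_sum (R : comNzRingType) I (s : seq I) (P : pred I) (F : I -> fps R) n :
  fcoef (\sum_(i <- s | P i) F i) n = \sum_(i <- s | P i) fcoef (F i) n.
Proof. by elim/big_rec2: _ => // i a b _ <-. Qed.

(** Pairs of [i] and a divisor of [i] become pairs of a part size [j.+1] and a number of copies
    [d.+1], with product [i]. *)
Lemma sum_divisors (V : nmodType) n (G : nat -> nat -> V) :
  \sum_(i < n.+1 | (0 < i)%N) \sum_(d <- divisors i) G d i =
  \sum_(j < n) \sum_(d < n | (j.+1 * d.+1 <= n)%N) G d.+1 (j.+1 * d.+1)%N.
Proof.
transitivity (\sum_(i < n.+1 | (0 < i)%N) \sum_(j < n)
    \sum_(d < n | (i == j.+1 * d.+1 :> nat)) G d.+1 i).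
  apply: eq_bigr => i i0; rewrite (exchange_big_dep predT) //=.
  have -> : \sum_(d <- divisors i) G d i =
      \sum_(1 <= d < n.+1 | (d %| i)%N) G d i.
    rewrite -[RHS]big_filter; apply: perm_big; apply: uniq_perm.
    - exact: divisors_uniq.
    - exact/filter_uniq/iota_uniq.
    move=> d; rewrite -dvdn_divisors // mem_filter mem_index_iota.
    case: (boolP (d %| i)%N) => //= di; rewrite (dvdn_gt0 i0 di) /=.
    by rewrite (leq_ltn_trans (dvdn_leq i0 di)).
  rewrite big_add1 /= big_mkord big_mkcond /=; apply: eq_bigr => d _.
  case: ifPn => [/dvdnP[k ik]|ndi].
    have kn : (k.-1 < n)%N by have := ltn_ord i; nia.
    have k0 : (0 < k)%N by nia.
    rewrite (big_pred1 (Ordinal kn)) // => j /=.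
    by rewrite -val_eqE /= ik eqn_pmul2r //; lia.
  rewrite big_pred0 // => j; apply: contraNF ndi => /eqP ->; exact: dvdn_mull.
rewrite exchange_big /=; apply: eq_bigr => j _.
rewrite (exchange_big_dep predT) // [RHS]big_mkcond; apply: eq_bigr => d _.
case: (leqP (j.+1 * d.+1) n) => [jd|nj].
  rewrite (big_pred1 (Ordinal (jd : (j.+1 * d.+1 < n.+1)%N))) // => i /=.
  by rewrite -val_eqE /=; case: eqP => [->|//]; rewrite ?andbT ?andbF.
rewrite big_pred0 // => i; apply/negP => /andP[_ /eqP ij].
by have := ltn_ord i; rewrite ij ltnS leqNgt nj.
Qed.

Lemma P_L_rec r :
  P_L r.+1 = \sum_(k < r.+1) 'C(r, k)%:R *: (D k.+1 * P_L (r - k)).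
Proof.
apply/fpsP => n; rewrite coef_P_L fcoef_sum.
(* [G d i] collects what remains after [d] copies of a part of size [i / d] are removed; the [+ d]
   restores the original number of parts. *)
pose G d i : rat := \sum_(f <- parts (n - i)) ((num_parts (n - i) f)%:R + d%:R) ^+ r.
transitivity (\sum_(i < n.+1 | (0 < i)%N) \sum_(d <- divisors i) G d i).
  rewrite sum_divisors.
  (* One factor of the power is the sum of the [f j], and [f j] is the number of [d] with
     [d.+1 <= f j]. *)
  transitivity (\sum_(f <- parts n) \sum_(j < n) \sum_(d < n)
      if (d.+1 <= f j)%N then (num_parts n f)%:R ^+ r else 0 : rat).
    rewrite !big_seq; apply: eq_bigr => f /mem_parts pf.
    rewrite exprS [X in X * _]natr_sum mulr_suml; apply: eq_bigr => j _.
    have fn : (f j <= n)%N by have := is_part_le j pf; nia.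
    rewrite -big_mkcond /=; transitivity (\sum_(d < f j) (num_parts n f)%:R ^+ r : rat).
      by rewrite sumr_const card_ord mulr_natl.
    exact: (big_ord_widen _ (fun=> (num_parts n f)%:R ^+ r)).
  rewrite exchange_big /=; apply: eq_bigr => j _.
  rewrite exchange_big /= [RHS]big_mkcond; apply: eq_bigr => d _.
  rewrite -big_mkcond /= sum_remove_part /G; case: ifP => // jd.
  rewrite !big_seq; apply: eq_bigr => g /mem_parts pg.
  by rewrite num_parts_add_part // (num_parts_widen pg) ?leq_subr // natrD.
transitivity (\sum_(k < r.+1) 'C(r, k)%:R * \sum_(i < n.+1)
    fcoef (D k.+1) i * fcoef (P_L (r - k)) (n - i)); last by [].
under [RHS]eq_bigr do rewrite mulr_sumr.
rewrite exchange_big big_mkcond /=; apply: eq_bigr => i _.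
case: ifP => i0; last by rewrite big1 // => k _; rewrite mul0r mulr0.
rewrite /sigma; under [RHS]eq_bigr => k _.
  rewrite -[\sum_(la : _) _]/(fcoef (P_L (r - k)) (n - i)) coef_P_L.
  rewrite subn1 /= natr_sum mulr_suml mulr_sumr.
  over.
rewrite [RHS]exchange_big /=. apply: eq_bigr => d _; rewrite /G.
under [RHS]eq_bigr do rewrite mulr_sumr mulr_sumr.
(* The binomial theorem yields the powers [d ^ k] whose divisor sum is the coefficient of
   [D k.+1]. *)
rewrite [RHS]exchange_big /=; apply: eq_bigr => f _; rewrite exprDn.
by apply: eq_bigr => k _; rewrite natrX -mulr_natl [X in _ * X]mulrC.
Qed.

Lemma calP_L_rec r :
  calP_L r.+1 = \sum_(k < r.+1) 'C(r, k)%:R *: (D k.+1 * calP_L (r - k)).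
Proof.
rewrite /calP_L P_L_rec mulr_sumr; apply: eq_bigr => k _.
by rewrite -scalerAr mulrCA.
Qed.

(** * Euler's product for the partition generating function *)

Lemma fcoef_mul_eq (R : comNzRingType) (f f' g g' : fps R) n :
  (forall i, (i <= n)%N -> fcoef f i = fcoef f' i) ->
  (forall i, (i <= n)%N -> fcoef g i = fcoef g' i) ->
  fcoef (f * g) n = fcoef (f' * g') n.
Proof.
move=> ff gg; apply: eq_bigr => i _.
by rewrite ff ?gg ?leq_subr // -ltnS.
Qed.

(** Zeroth powers are 1, even for the empty partition, so [P_L 0] counts partitions. Up to degree
    [n] both it and [qinf] agree with finite products, whose product is 1 up to that degree. *)
Lemma calP_L0 : calP_L 0 = 1.
Proof.
apply/fpsP => n; pose q := fps_q rat.
(* Parts and multiplicities at most [n] account for every partition of size at most [n]. *)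
pose Q := \prod_(j < n) \sum_(k < n.+1) (q ^+ j.+1) ^+ k.
have QE : Q = \sum_(m : {ffun 'I_n -> 'I_n.+1}) q ^+ (\sum_(j < n) j.+1 * m j)%N.
  rewrite /Q bigA_distr_bigA /=; apply: eq_bigr => m _.
  by rewrite expr_sum; apply: eq_bigr => j _; rewrite exprM.
have PQ i : (i <= n)%N -> fcoef (P_L 0) i = fcoef Q i.
  move=> i_n; rewrite coef_P_L QE fcoef_sum.
  pose ext (m : {ffun 'I_n -> 'I_n.+1}) (k : nat) : nat :=
    oapp (fun j : 'I_n => m j : nat) 0%N (insub k).
  have extE m (j : 'I_n) : ext m j = m j by rewrite /ext valK.
  have ext0 m k : (n <= k)%N -> ext m k = 0%N.
    by move=> nk; rewrite /ext insubF // ltnNge nk.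
  have wext m : weight n (ext m) = (\sum_(j < n) j.+1 * m j)%N.
    by apply: eq_bigr => j _; rewrite extE.
  have pp : perm_eq (parts i)
      [seq ext m | m <- index_enum {ffun 'I_n -> 'I_n.+1} &
      weight n (ext m) == i].
    apply: uniq_perm; rewrite ?parts_uniq //.
      rewrite map_inj_uniq ?filter_uniq ?index_enum_uniq // => m m' em; apply/ffunP => j.
      by apply/val_inj; rewrite /= -!extE em.
    move=> f; apply/idP/mapP => [/mem_parts pf|[m]]; last first.
      rewrite mem_filter => /andP[/eqP wm _] ->; apply/mem_parts.
      by apply: is_partP wm => k; exact: ext0.
    have fE : ext [ffun j : 'I_n => inord (f j)] = f.
      apply/funext => k; have [nk|kn] := leqP n k.
        by rewrite ext0 // pf.1 // (leq_trans i_n nk).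
      rewrite (extE _ (Ordinal kn)) ffunE inordK //= ltnS.
      by have := is_part_le k pf; nia.
    exists [ffun j : 'I_n => inord (f j)] => //.
    by rewrite mem_filter mem_index_enum fE (is_part_weight pf) // eqxx.
  rewrite (perm_big _ pp) big_map big_filter big_mkcond /=.
  apply: eq_bigr => m _; rewrite expr0 fcoef_q_exp -wext eq_sym.
  by case: eqP.
rewrite (fcoef_mul_eq (f' := qinf_partial rat n) (g' := Q)) //; last first.
  move=> i i_n; have [N HN] := qinf_cvg rat i.
  rewrite -(HN _ (leq_maxl N n)) (qinf_partial_stable _ i_n).
  by rewrite (qinf_partial_stable _ (leq_trans i_n (leq_maxr N n))).
have -> : qinf_partial rat n * Q =
    \prod_(j < n) ((1 - q ^+ j.+1) * \sum_(k < n.+1) (q ^+ j.+1) ^+ k).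
  by rewrite /qinf_partial big_add1 big_mkord -big_split.
have : forall i, (i <= n)%N ->
    fcoef (\prod_(j < n) ((1 - q ^+ j.+1) * \sum_(k < n.+1) (q ^+ j.+1) ^+ k)) i
    = fcoef 1 i.
  elim/big_ind: _ => // [F G HF HG i i_n|j _ i i_n].
    rewrite -[1 in RHS]mulr1; apply: fcoef_mul_eq => k ki; [apply: HF|apply: HG];
    exact: leq_trans ki i_n.
  (* The geometric sum telescopes to [1 - q ^+ (j.+1 * n.+1)], whose exponent exceeds [n]. *)
  rewrite -opprB mulNr -subrX1 opprB -exprM.
  rewrite -[LHS]/(fcoef 1 i - fcoef (q ^+ (j.+1 * n.+1)) i).
  by rewrite fcoef_q_exp (_ : (i == _) = false) ?subr0 //; lia.
by apply.
Qed.

(** * The two expansions for [calP_L] and [D] *)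

Theorem corollary3p2 :
  (forall r : nat, (1 <= r)%N ->
     calP_L r = \sum_(la : intpart r) phiB la *: D_part la) /\
  (forall k : nat, (1 <= k)%N ->
     D k = \sum_(la : intpart k) (mu la * phiB la) *: calP_L_part la).
Proof.
pose y n : fps rat := n`!%:R^-1 *: D n.
pose p n : fps rat := n`!%:R^-1 *: calP_L n.
have fact_neq0 n : n`!%:R != 0 :> rat by rewrite pnatr_eq0 -lt0n fact_gt0.
have p0 : p 0%N = 1 by rewrite /p calP_L0 invr1 scale1r.
(* This is [calP_L_rec] divided by n!, with 'C(n, k) / n! = 1 / (k! (n - k)!). *)
have py : exp_rec y p.
  move=> n; rewrite /p calP_L_rec !scaler_sumr; apply: eq_bigr => k _.
  have kn : (k <= n)%N by rewrite -ltnS.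
  rewrite /y -!scalerAl -!scalerAr !scalerA; congr (_ *: _).
  have nE : n`!%:R = 'C(n, k)%:R * (k`!%:R * (n - k)`!%:R) :> rat.
    by rewrite -!natrM bin_fact.
  rewrite !factS !natrM !invfM ![_ * (_ * _^-1)]mulrA !mulfV ?pnatr_eq0 // !mul1r.
  by rewrite nE invfM mulrAC mulVf ?mul1r ?invfM // pnatr_eq0 -lt0n bin_gt0.
(* The factors j!^(-m_j) of [phiB] come from the normalisation of [z], and the 1 / m_j! from
   [part_weight]. *)
have weightE (z x : nat -> fps rat) n (la : intpart n) :
    (forall j, z j = j`!%:R^-1 *: x j) ->
    n`!%:R *: part_weight n z (mult_fun la) =
    phiB la *: \prod_(j < n) x j.+1 ^+ la j.
  move=> zx; rewrite /phiB -scalerA -scaler_prod; congr (_ *: _).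
  apply: eq_bigr => j _; rewrite zx exprZn scalerA mult_funE; congr (_ *: _).
  by rewrite exprVn mul1r invfM.
split=> [r _|[//|k] _].
  have -> : calP_L r = r`!%:R *: p r by rewrite /p scalerA mulfV ?scale1r.
  rewrite (exp_partsE p0 py) /part_sum -sum_parts scaler_sumr.
  by apply: eq_bigr => la _; rewrite scale1r (weightE _ D).
have -> : D k.+1 = k.+1`!%:R *: y k.+1 by rewrite /y scalerA mulfV ?scale1r.
rewrite (log_partsE p0 py) /part_sum -sum_parts scaler_sumr.
apply: eq_bigr => la _; rewrite scalerA mulrC -[LHS]scalerA (weightE _ calP_L) //.
(* [mu la] is by definition [log_coef] at the length of [la]. *)
by rewrite scalerA -plengthE.
Qed.
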